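(* Let $\lambda$ and $\beta$ be positive random variables on a probability space $(\Omega,\mathcal F,\mathbb P)$ satisfying $$\mathbb E\left[\frac{\beta}{\lambda^{1/\beta}}\left(\frac{\beta+1}{\beta}\right)^{\frac{\beta+1}{\beta}}\right]<\infty,\qquad \mathbb E[\lambda]<\infty,\qquad \mathbb E[\lambda\beta]<\infty ,$$ and let $f$ be the PDF of the Kies mixture with CDF $F(t)=\mathbb E[H(t;\lambda,\beta)]$. Then $f(1)=0$, and the left endpoint value is as follows. 1. If $\mathbb P(\beta>1)=1$, then $f(0)=0$. 2. If $\mathbb P(\beta=1)>0$ and $\mathbb P(\beta<1)=0$, then $f(0)=\mathbb Q(\beta=1)\,\mathbb E[\lambda]$, where $\mathbb Q$ is the probability measure equivalent to $\mathbb P$ with Radon--Nikodym derivative $\frac{d\mathbb Q}{d\mathbb P}=\frac{\lambda}{\mathbb E[\lambda]}$. 3. If $\mathbb P(\beta<1)>0$, then $f(0)=\infty$.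
   Context: For constants $\lambda,\beta>0$ the Kies distribution on $(0,1)$ has CDF $H(t;\lambda,\beta)=1-\exp\left(-\lambda\left(\frac{t}{1-t}\right)^\beta\right)$. For random $\lambda,\beta$ it is evaluated pointwise in $\omega$. $\mathbb E$ is expectation with respect to $\mathbb P$. The mixture PDF is $f=F'$ on $(0,1)$, and the endpoint values are understood as limits: $f(0)=\lim_{t\to0^+}f(t)$, $f(1)=\lim_{t\to1^-}f(t)$. *)

(* Defs.v *)
From HB Require Import structures.
From mathcomp Require Import all_boot all_order all_algebra.
From mathcomp Require Import all_classical all_reals all_analysis.

Set Implicit Arguments.
Unset Strict Implicit.
Unset Printing Implicit Defensive.

Import Order.TTheory GRing.Theory Num.Theory.
Import numFieldNormedType.Exports.

Local Open Scope classical_set_scope.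
Local Open Scope ring_scope.
Local Open Scope charge_scope.

(* This is the CDF only for 0 < t < 1: outside that interval the formula is
   not continued by 0 and 1. *)
Definition kies_cdf (R : realType) (lambda beta t : R) : R :=
  1 - expR (- lambda * (t / (1 - t)) `^ beta).

Definition kies_mixture_cdf (R : realType) (d : measure_display)
    (T : measurableType d) (P : probability T R)
    (lambda beta : {RV P >-> R}) (t : R) : R :=
  fine 'E_P[fun w => kies_cdf (lambda w) (beta w) t]%E.

(* derive1 is total, so this is the derivative only where the mixture CDF is
   derivable. *)
Definition kies_mixture_pdf (R : realType) (d : measure_display)
    (T : measurableType d) (P : probability T R)
    (lambda beta : {RV P >-> R}) : R -> R :=
  derive1 (kies_mixture_cdf lambda beta).

(* The library's Radon-Nikodym derivative is defined for charges, whence the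
   cast charge_of_finite_measure, and only up to P-almost-everywhere equality. *)
Definition equivalent_with_density (R : realType) (d : measure_display)
    (T : measurableType d) (P Q : probability T R) (g : T -> R) : Prop :=
  [/\ Q `<< P, P `<< Q &
      ae_eq P setT ('d (charge_of_finite_measure Q) '/d P) (EFin \o g)].

(* Main.v *)
(* Write x = t / (1 - t) and u = lambda x^beta. The Kies density is
   h(t) = beta u e^(-u) / (t (1 - t)) <= beta / (t (1 - t)), and E[beta] is
   finite since beta <= lambda beta + beta / lambda^(1/beta); hence one may
   differentiate under the expectation and f(t) = E[h(t)].
   Near 1, h(t) = beta lambda^(-1/beta) u^p e^(-u) / t^2 with
   p = (beta + 1) / beta, and u^p e^(-u) <= p^p makes the moment hypothesis a dominating function.
   Near 0, if beta >= 1, then h(t) <= 4 lambda beta and h(t) tends to lambda when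
   beta = 1 and to 0 otherwise; dominated convergence gives E[lambda; beta = 1].
   If beta < 1 has positive probability, then for some e > 0 the event
   {beta <= 1 - e, lambda beta e^(-lambda) >= e} does too, and there
   h(t) >= e x^(-e). *)

Require Import Defs.
From HB Require Import structures.
From mathcomp Require Import all_boot all_order all_algebra.
From mathcomp Require Import all_classical all_reals all_analysis.
From mathcomp Require Import measurable_realfun ring lra.

Set Implicit Arguments.
Unset Strict Implicit.

Import Order.TTheory GRing.Theory Num.Theory.
Import numFieldNormedType.Exports.

Local Open Scope classical_set_scope.
Local Open Scope ring_scope.

(** * Pointwise bounds on the Kies density for fixed parameters *)

Definition kies_pdf (R : realType) (l b t : R) : R :=
  l * b * (t / (1 - t)) `^ (b - 1) * (1 - t) ^- 2
  * expR (- l * (t / (1 - t)) `^ b).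

Lemma odds_gt0 (R : realType) (t : R) : 0 < t < 1 -> 0 < t / (1 - t).
Proof. by case/andP=> t0 t1; rewrite divr_gt0 ?subr_gt0. Qed.

Lemma is_derive_kies_cdf (R : realType) (l b t : R) : 0 < t < 1 ->
  is_derive t 1 (kies_cdf l b) (kies_pdf l b t).
Proof.
move=> t01; have x0 := odds_gt0 t01; case/andP: t01 => t0 t1.
have t1' : 1 - t != 0 by rewrite subr_eq0 gt_eqF.
have dV : is_derive t 1 (fun u : R => (1 - u)^-1) ((1 - t) ^- 2).
  have -> : (1 - t) ^- 2 = - (1 - t) ^- 2 *: (0 - 1) :> R.
    by rewrite sub0r scalerN scaleNr opprK scaler1.
  exact: is_deriveV.
have dx : is_derive t 1 (fun u : R => u / (1 - u)) ((1 - t) ^- 2).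
  by apply: is_derive_eq; rewrite /GRing.scale /=; field.
have dpow : is_derive t 1 (fun u : R => (u / (1 - u)) `^ b)
    (b * (t / (1 - t)) `^ (b - 1) * (1 - t) ^- 2).
  exact: (@is_derive1_comp R _ _ t _ _ (is_derive1_powR b x0) dx).
have darg : is_derive t 1 (fun u : R => - l * (u / (1 - u)) `^ b)
    (- l * (b * (t / (1 - t)) `^ (b - 1) * (1 - t) ^- 2)).
  exact: is_deriveZ.
have dexp : is_derive t 1 (fun u : R => expR (- l * (u / (1 - u)) `^ b))
    (expR (- l * (t / (1 - t)) `^ b) *
     (- l * (b * (t / (1 - t)) `^ (b - 1) * (1 - t) ^- 2))).
  exact: (@is_derive1_comp R expR (fun u : R => - l * (u / (1 - u)) `^ b)).
by rewrite /kies_cdf /kies_pdf; apply: is_derive_eq; ring.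
Qed.

(** After taking logarithms this is [p * ln (u / p) <= u - p], that is, [ln y <= y - 1] at
    [y = u / p]. *)
Lemma powR_expRN_le (R : realType) (p u : R) : 0 < p -> 0 < u ->
  u `^ p * expR (- u) <= p `^ p.
Proof.
move=> p0 u0; rewrite /powR !gt_eqF// -expRD ler_expR.
have h : ln (u / p) <= u / p - 1.
  have := @le_ln1Dx R (u / p - 1).
  by rewrite [1 + _]addrC subrK => -> //; rewrite ltrBrDr addNr divr_gt0.
move: h; rewrite ln_div ?posrE// -(ler_pM2l p0).
have -> : p * (u / p - 1) = u - p by field; rewrite gt_eqF.
lra.
Qed.

Section pdf_bounds.
Context {R : realType}.
Variables l b : R.
Hypotheses (l0 : 0 < l) (b0 : 0 < b).

Lemma kies_pdf_ge0 t : 0 < t < 1 -> 0 <= kies_pdf l b t.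
Proof.
case/andP=> t0 t1.
by rewrite /kies_pdf !mulr_ge0 ?expR_ge0 ?powR_ge0 ?invr_ge0 ?exprn_ge0 ?subr_ge0 ?ltW.
Qed.

(** The factor left over is [u * expR (- u)], at most 1 because [u <= 1 + u <= expR u]. The bound is
    linear in [b] and uniform in [l], so on a compact part of []0, 1[] a multiple of [b]
    dominates. *)
Lemma kies_pdf_le_inner t : 0 < t < 1 -> kies_pdf l b t <= b / (t * (1 - t)).
Proof.
move=> t01; have x0 := odds_gt0 t01; case/andP: t01 => t0 t1.
have s0 : 0 < 1 - t by rewrite subr_gt0.
rewrite /kies_pdf powRB ?(gt_eqF x0) ?implybT// powRr1 ?(ltW x0)//.
set u := l * (t / (1 - t)) `^ b.
have -> : l * b * ((t / (1 - t)) `^ b / (t / (1 - t))) / (1 - t) ^+ 2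
    * expR (- l * (t / (1 - t)) `^ b) = b / (t * (1 - t)) * (u * expR (- u)).
  by rewrite /u mulNr; field; rewrite !gt_eqF.
rewrite ler_piMr//; first by rewrite divr_ge0 ?mulr_ge0 ?ltW.
rewrite expRN ler_pdivrMr ?expR_gt0// mul1r.
by apply: le_trans (expR_ge1Dx u); rewrite lerDr.
Qed.

(** For [t <= 1/2] one has [(1 - t) ^- 2 <= 4], and the exponential is at most 1. The power of the
    odds is kept: it gives the limit 0 when [b > 1], and it is at most 1 when [b >= 1]. *)
Lemma kies_pdf_le_near0 t : 0 < t <= 2^-1 ->
  kies_pdf l b t <= 4 * (l * b) * (t / (1 - t)) `^ (b - 1).
Proof.
case/andP=> t0 t2; have t01 : 0 < t < 1 by lra.
rewrite /kies_pdf.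
have s0 : 0 < 1 - t by lra.
have -> : 4 * (l * b) * (t / (1 - t)) `^ (b - 1) =
  l * b * (t / (1 - t)) `^ (b - 1) * 4 * 1 by ring.
apply: ler_pM.
- by rewrite !mulr_ge0 ?powR_ge0 ?invr_ge0 ?exprn_ge0 ?ltW.
- exact: expR_ge0.
- apply: ler_wpM2l; first by rewrite !mulr_ge0 ?powR_ge0 ?ltW.
  by rewrite invf_ple ?posrE ?exprn_gt0//; nra.
- by rewrite -expR0 ler_expR mulNr oppr_le0 mulr_ge0 ?powR_ge0 ?ltW.
Qed.

(** For [t <= 1/2] the odds are at most 1, so the exponential is at least [expR (- l)]; also
    [(1 - t) ^- 2 >= 1]. *)
Lemma kies_pdf_ge_near0 t : 0 < t <= 2^-1 ->
  l * b * expR (- l) * (t / (1 - t)) `^ (b - 1) <= kies_pdf l b t.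
Proof.
case/andP=> t0 t2; have t01 : 0 < t < 1 by lra.
have x0 := odds_gt0 t01.
have s0 : 0 < 1 - t by lra.
have x1 : t / (1 - t) <= 1 by rewrite ler_pdivrMr//; lra.
rewrite /kies_pdf.
have -> : l * b * expR (- l) * (t / (1 - t)) `^ (b - 1) =
  l * b * (t / (1 - t)) `^ (b - 1) * 1 * expR (- l) by ring.
apply: ler_pM.
- by rewrite !mulr_ge0 ?powR_ge0 ?ltW.
- exact: expR_ge0.
- apply: ler_wpM2l; first by rewrite !mulr_ge0 ?powR_ge0 ?ltW.
  by rewrite invf_pge ?posrE ?exprn_gt0//; nra.
- rewrite ler_expR mulNr lerN2 ler_piMr ?(ltW l0)//.
  by rewrite -[leRHS](powRr0 (t / (1 - t))) ger_powR ?x0 ?x1 ?(ltW b0).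
Qed.

(** With [x] the odds, the exponent is chosen so that [(l * x]^ b) [^ ((b + 1) / b)] is [l * l]^ (1
    / b) * x [^ (b - 1) * x ^+ 2], and [x ^+ 2 / t ^+ 2] is [(1 - t) ^- 2]. *)
Lemma kies_pdf_near1E t : 0 < t < 1 ->
  kies_pdf l b t = b / l `^ (1 / b) * (t ^- 2 *
    ((l * (t / (1 - t)) `^ b) `^ ((b + 1) / b) * expR (- (l * (t / (1 - t)) `^ b)))).
Proof.
move=> t01; have x0 := odds_gt0 t01; case/andP: t01 => t0 t1.
have s0 : 0 < 1 - t by rewrite subr_gt0.
have b0' : b != 0 by rewrite gt_eqF.
rewrite powRM ?powR_ge0 ?(ltW l0)// -powRrM.
have -> : b * ((b + 1) / b) = (b - 1) + 2 by field.
have -> : (b + 1) / b = 1 + 1 / b by field.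
rewrite (powRD (x := l)) ?(gt_eqF l0) ?implybT// powRr1 ?(ltW l0)//.
rewrite (powRD (r := b - 1)) ?(gt_eqF x0) ?implybT//.
rewrite (powR_mulrn 2) ?(ltW x0)// /kies_pdf mulNr.
have p0 : 0 < l `^ (1 / b) by rewrite powR_gt0.
by field; rewrite !gt_eqF.
Qed.

Let moment := b / l `^ (1 / b) * ((b + 1) / b) `^ ((b + 1) / b).

(* [moment] comes from the maximum of [u `^ p * expR (- u)], attained at
   [u = p = (b + 1) / b]. *)
Lemma kies_pdf_le_near1 t : 2^-1 <= t < 1 -> kies_pdf l b t <= 4 * moment.
Proof.
case/andP=> t0 t1; have t01 : 0 < t < 1 by lra.
rewrite kies_pdf_near1E// /moment [leRHS]mulrCA.
apply: ler_wpM2l; first by rewrite divr_ge0 ?powR_ge0 ?ltW.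
apply: ler_pM; rewrite ?mulr_ge0 ?powR_ge0 ?expR_ge0//.
- by rewrite invr_ge0 exprn_ge0//; lra.
- by rewrite invf_ple ?posrE ?exprn_gt0//; nra.
- by rewrite powR_expRN_le// ?divr_gt0 ?mulr_gt0 ?powR_gt0 ?odds_gt0// addr_gt0.
Qed.

End pdf_bounds.

(** * One-sided limits and dominated convergence along filters *)

Lemma cvg_at_right_near (R : realType) (I : Type) (F : set_system I)
    (FF : Filter F) (f : I -> R) (p : R) :
  f i @[i --> F] --> p -> (\forall i \near F, p < f i) -> f i @[i --> F] --> p^'+.
Proof.
move=> fp pf A pA; have h := fp [set u | p < u -> A u] pA.
by apply: filterS2 h pf => i /=; exact.
Qed.

Lemma cvg_at_left_near (R : realType) (I : Type) (F : set_system I)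
    (FF : Filter F) (f : I -> R) (p : R) :
  f i @[i --> F] --> p -> (\forall i \near F, f i < p) -> f i @[i --> F] --> p^'-.
Proof.
move=> fp pf A pA; have h := fp [set u | u < p -> A u] pA.
by apply: filterS2 h pf => i /=; exact.
Qed.

(** Dominated convergence speaks of sequences; this property of [F] carries its conclusion over to a
    continuous parameter. *)
Definition sequential_filter (R : realType) (F : set_system R) :=
  forall (g : R -> R) (l : R),
    (forall u : nat -> R, u n @[n --> \oo] --> F -> g (u n) @[n --> \oo] --> l) ->
    g t @[t --> F] --> l.

Lemma at_right_sequential (R : realType) (p : R) : sequential_filter p^'+.
Proof.
move=> g l gl; apply/cvg_at_rightP => u [pu up].
by apply: gl; apply: cvg_at_right_near => //; exact: nearW.
Qed.

Lemma at_left_sequential (R : realType) (p : R) : sequential_filter p^'-.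
Proof.
move=> g l gl; apply/cvg_at_leftP => u [pu up].
by apply: gl; apply: cvg_at_left_near => //; exact: nearW.
Qed.

Lemma cvg_Rintegral_dominated (R : realType) (d : measure_display)
    (T : measurableType d) (mu : {measure set T -> \bar R}) (F : set_system R)
    (FF : Filter F) (D : set R) (k : R -> T -> R) (h g : T -> R) :
  sequential_filter F -> F D ->
  (forall t, D t -> measurable_fun setT (k t)) -> measurable_fun setT h ->
  mu.-integrable setT (EFin \o g) ->
  {ae mu, forall w, (k t w @[t --> F] --> h w) /\
    forall t, D t -> `|k t w| <= g w} ->
  \int[mu]_w k t w @[t --> F] --> \int[mu]_w h w.
Proof.
move=> sF FD mk mh intg kh; apply: sF => u uF.
(* The domination is assumed on [D] only, which the sequence enters eventually; dropping [N] terms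
   puts all of it in [D]. *)
have [N _ DN] : \forall n \near \oo, D (u n) by exact: uF.
have Du n : D (u (n + N)%N) by apply: DN => /=; exact: leq_addl.
rewrite -(cvg_shiftn N).
have [|||||inth _ kch] := @dominated_convergence _ _ _ mu setT measurableT
  (fun n w => (k (u (n + N)%N) w)%:E) (EFin \o h) (EFin \o g).
- by move=> n; apply/measurable_EFinP; exact: mk.
- exact/measurable_EFinP.
- apply: filterS kh => w [kw _] _; apply/fine_cvgP; split; first exact: nearW.
  have := @cvg_shiftn N _ (fun n => k (u n) w) (nbhs (h w)).
  by rewrite /comp/= => ->; exact: cvg_comp kw.
- exact: intg.
- by apply: filterS kh => w [_ kw] n _; rewrite lee_fin kw.
- apply: fine_cvg; rewrite fineK; first exact: kch.
  exact: integrable_fin_num.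
Qed.

(** * Endpoint limits of the density for fixed parameters *)

Lemma odds_cvg0 (R : realType) : t / (1 - t) @[t --> (0 : R)^'+] --> (0 : R)^'+.
Proof.
apply: cvg_at_right_near.
  rewrite -[X in _ --> X](mul0r (1 - 0 : R)^-1).
  apply: cvg_at_right_filter.
  apply: cvgM; first exact: cvg_id.
  apply: cvgV; first by rewrite subr0 oner_eq0.
  by apply: cvgB; [exact: cvg_cst|exact: cvg_id].
near=> t; apply: odds_gt0; apply/andP; split; near: t.
  exact: nbhs_right_gt.
exact: nbhs_right_lt.
Unshelve. all: by end_near. Qed.

Section pdf_limits.
Context {R : realType}.
Variables l b : R.
Hypotheses (l0 : 0 < l) (b0 : 0 < b).

Lemma kies_pdf_cvg0_gt1 : 1 < b -> kies_pdf l b t @[t --> 0^'+] --> (0 : R).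
Proof.
move=> b1.
have h : 4 * (l * b) * (t / (1 - t)) `^ (b - 1) @[t --> (0:R)^'+] --> (0 : R).
  rewrite -[X in _ --> X](mulr0 (4 * (l * b))); apply: cvgMr.
  apply: (cvg_comp _ (fun a : R => a `^ (b - 1)) (@odds_cvg0 R)).
  by apply: powR_cvg0; rewrite subr_gt0.
apply: (squeeze_cvgr _ (cvg_cst 0) h).
near=> t; have t0 : 0 < t by near: t; exact: nbhs_right_gt.
have t2 : t <= 2^-1 by near: t; apply: nbhs_right_le; rewrite invr_gt0.
rewrite kies_pdf_ge0//=; last by lra.
by rewrite kies_pdf_le_near0// t0 t2.
Unshelve. all: by end_near. Qed.

Lemma kies_pdf_cvg0_eq1 : b = 1 -> kies_pdf l b t @[t --> 0^'+] --> l.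
Proof.
move=> ->.
have x0 : t / (1 - t) @[t --> (0:R)^'+] --> (0 : R).
  apply: cvg_trans (@odds_cvg0 R) _; exact: cvg_within.
(* For exponent 1 both powers simplify where the odds are nonnegative, hence near [0^'+]; what
   remains is continuous at 0. *)
apply: (@cvg_trans _ (l * (1 - t) ^- 2 * expR (- l * (t / (1 - t))) @[t --> 0^'+])).
  apply: near_eq_cvg; near=> t.
  have t0 : 0 < t by near: t; exact: nbhs_right_gt.
  have t1 : t < 1 by near: t; exact: nbhs_right_lt.
  rewrite /kies_pdf subrr powRr0 !mulr1 powRr1//.
  by rewrite ltW// odds_gt0// t0 t1.
have -> : nbhs l = nbhs (l * (1 - 0) ^- 2 * expR (- l * 0)).
  by rewrite subr0 expr1n invr1 mulr0 expR0 !mulr1.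
apply: cvgM.
  apply: cvgMr; apply: cvg_at_right_filter; apply: cvgV.
    by rewrite subr0 expr1n oner_eq0.
  by rewrite expr2; apply: cvgM; (apply: cvgB; [exact: cvg_cst|exact: cvg_id]).
apply: (cvg_comp (fun t : R => - l * (t / (1 - t)))); last exact: continuous_expR.
exact: cvgMr.
Unshelve. all: by end_near. Qed.

Lemma kies_pdf_cvg1 : kies_pdf l b t @[t --> 1^'-] --> (0 : R).
Proof.
set p := (b + 1) / b; have p0 : 0 < p by rewrite divr_gt0// addr_gt0.
(* The 4 bounds [t ^- 2] for [t >= 1/2], [(p + 1)]^ (p + 1)[bounds]u [^ (p + 1) * expR (- u)], and
   [1 / l] comes from [1 / u]. *)
pose C := b / l `^ (1 / b) * (4 * ((p + 1) `^ (p + 1) / l)).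
(* [u `^ p * expR (- u)] tends to 0 as it equals
   [u `^ (p + 1) * expR (- u) / u <= (p + 1) `^ (p + 1) / u]. *)
have h : C * (2 * (1 - t)) `^ b @[t --> (1 : R)^'-] --> (0 : R).
  rewrite -[X in _ --> X](mulr0 C); apply: cvgMr.
  apply: (@cvg_comp _ _ _ (fun t => 2 * (1 - t)) (fun a => a `^ b) _ (0 : R)^'+);
    last exact: powR_cvg0.
  apply: cvg_at_right_near.
    rewrite -[X in _ --> X](mulr0 (2 : R)) -(subrr (1 : R)); apply: cvgMr.
    by apply: cvg_at_left_filter; apply: cvgB; [exact: cvg_cst|exact: cvg_id].
  near=> t; rewrite mulr_gt0// subr_gt0; near: t; exact: nbhs_left_lt.
apply: (squeeze_cvgr _ (cvg_cst 0) h).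
near=> t; have t1 : t < 1 by near: t; exact: nbhs_left_lt.
have t2 : 2^-1 <= t by near: t; apply: nbhs_left_ge; lra.
have t01 : 0 < t < 1 by lra.
have x0 := odds_gt0 t01.
rewrite kies_pdf_ge0//= kies_pdf_near1E// /C -[leRHS]mulrA.
apply: ler_wpM2l; first by rewrite divr_ge0 ?powR_ge0 ?ltW.
set u := l * _; have u0 : 0 < u by rewrite mulr_gt0 ?powR_gt0.
rewrite -[leRHS]mulrA; apply: ler_pM; rewrite ?mulr_ge0 ?powR_ge0 ?expR_ge0//.
- by rewrite invr_ge0 exprn_ge0//; lra.
- by rewrite invf_ple ?posrE ?exprn_gt0//; nra.
- have -> : u `^ p * expR (- u) = u `^ (p + 1) * expR (- u) * u^-1.
    rewrite powRD ?(gt_eqF u0) ?implybT// powRr1 ?(ltW u0)//.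
    by field; rewrite gt_eqF.
  rewrite -[leRHS]mulrA; apply: ler_pM; rewrite ?mulr_ge0 ?powR_ge0 ?expR_ge0 ?invr_ge0 ?(ltW u0)//.
    by apply: powR_expRN_le => //; rewrite addr_gt0.
  (* The inverse odds are [(1 - t) / t <= 2 * (1 - t)], since [t >= 1/2]. *)
  rewrite /u invfM; apply: ler_wpM2l; first by rewrite invr_ge0 ltW.
  rewrite -powRN -[- b]mulN1r powRrM powR_inv1 ?(ltW x0)//.
  apply: ge0_ler_powR; rewrite ?nnegrE ?invr_ge0 ?(ltW x0) ?(ltW b0)//.
    by rewrite mulr_ge0// subr_ge0 ltW.
  by rewrite invf_div ler_pdivrMr; nra.
Unshelve. all: by end_near. Qed.

End pdf_limits.

(** * Measurability, integrability and differentiation under the expectation *)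

Lemma measurable_fun_powR_gt0 (R : realType) (d : measure_display)
    (T : measurableType d) (f g : T -> R) :
  (forall w, 0 < f w) -> measurable_fun setT f -> measurable_fun setT g ->
  measurable_fun setT (fun w => f w `^ g w).
Proof.
move=> f0 mf mg.
(* A positive base avoids the separate value of [powR] at base 0. *)
rewrite [X in measurable_fun _ X](_ : _ = (fun w => expR (g w * ln (f w)))).
  apply: measurableT_comp => //; apply: measurable_funM => //.
  exact: measurableT_comp.
by apply/funext => w; rewrite /powR gt_eqF.
Qed.

Lemma measurable_funV_gt0 (R : realType) (d : measure_display)
    (T : measurableType d) (f : T -> R) :
  (forall w, 0 < f w) -> measurable_fun setT f ->
  measurable_fun setT (fun w => (f w)^-1).
Proof.
move=> f0 mf.
rewrite [X in measurable_fun _ X](_ : _ = (fun w => f w `^ (-1))).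
  exact: measurable_fun_powR_gt0.
by apply/funext => w; rewrite powR_inv1// ltW.
Qed.

Lemma integrable_expectation_lty (R : realType) (d : measure_display)
    (T : measurableType d) (P : probability T R) (f : T -> R) :
  (forall w, 0 <= f w) -> measurable_fun setT f -> ('E_P[f] < +oo)%E ->
  P.-integrable setT (EFin \o f).
Proof.
move=> f0 mf; rewrite unlock => flty; apply/integrableP; split.
  exact/measurable_EFinP.
by under eq_integral do rewrite /= ger0_norm//.
Qed.

Section mixture.
Context {R : realType} {d : measure_display} {T : measurableType d}.
Variables (P : probability T R) (lambda beta : {RV P >-> R}).
Hypothesis lambda_gt0 : forall w, 0 < lambda w.
Hypothesis beta_gt0 : forall w, 0 < beta w.

Let moment w := beta w / (lambda w `^ (1 / beta w)) *
  ((beta w + 1) / beta w) `^ ((beta w + 1) / beta w).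

Lemma measurable_kies_pdf t : 0 < t < 1 ->
  measurable_fun setT (fun w => kies_pdf (lambda w) (beta w) t).
Proof.
move=> t01; have x0 := odds_gt0 t01.
have mpow (g : T -> R) : measurable_fun setT g ->
    measurable_fun setT (fun w => (t / (1 - t)) `^ g w).
  by move=> mg; apply: measurable_fun_powR_gt0.
apply: measurable_funM; last first.
  apply: measurableT_comp => //; apply: measurable_funM; last exact: mpow.
  exact: measurableT_comp.
apply: measurable_funM => //; apply: measurable_funM; first exact: measurable_funM.
by apply: mpow; apply: measurable_funB.
Qed.

Lemma measurable_kies_cdf t : 0 < t < 1 ->
  measurable_fun setT (fun w => kies_cdf (lambda w) (beta w) t).
Proof.
move=> t01; have x0 := odds_gt0 t01.
apply: measurable_funB => //; apply: measurableT_comp => //.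
apply: measurable_funM; first exact: measurableT_comp.
exact: measurable_fun_powR_gt0.
Qed.

Lemma integrable_kies_cdf t : 0 < t < 1 ->
  P.-integrable setT (EFin \o (fun w => kies_cdf (lambda w) (beta w) t)).
Proof.
move=> t01; have x0 := odds_gt0 t01.
apply: (@le_integrable _ _ _ _ _ measurableT _ (EFin \o cst 1)).
- exact/measurable_EFinP/measurable_kies_cdf.
- move=> w _; rewrite /= lee_fin normr1 /kies_cdf ger0_norm; last first.
    by rewrite subr_ge0 -expR0 ler_expR mulNr oppr_le0 mulr_ge0 ?powR_ge0 ?ltW.
  by rewrite lerBlDr lerDl expR_ge0.
- exact: finite_measure_integrable_cst.
Qed.

Lemma measurable_moment : measurable_fun setT moment.
Proof.
have mV := measurable_funV_gt0 beta_gt0 (measurable_funPT beta).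
have mq : measurable_fun setT (fun w => (beta w + 1) / beta w).
  by apply: measurable_funM => //; exact: measurable_funD.
have pl : forall w, 0 < lambda w `^ (1 / beta w) by move=> w; rewrite powR_gt0.
apply: measurable_funM.
  apply: measurable_funM => //; apply: measurable_funV_gt0 => //.
  apply: measurable_fun_powR_gt0 => //; exact: measurable_funM.
apply: measurable_fun_powR_gt0 => // w.
by rewrite divr_gt0// addr_gt0.
Qed.

Lemma moment_ge0 w : 0 <= moment w.
Proof. by rewrite /moment mulr_ge0 ?divr_ge0 ?powR_ge0 ?ltW. Qed.

(* If [lambda w >= 1] the first term is at least [beta w], otherwise the
   second one is. *)
Lemma beta_le w : beta w <= lambda w * beta w + moment w.
Proof.
have l0 := lambda_gt0 w; have b0 := beta_gt0 w; have m0 := moment_ge0 w.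
have [l1|l1] := leP 1 (lambda w); first by nra.
have bm : beta w <= moment w.
  rewrite /moment -mulrA ler_peMr ?(ltW b0)//.
  (* Both remaining factors are at least 1: [lambda w < 1] gives [lambda w]^ (1 / beta w) <=
     1[, and]1 <= q <= q [^ q]. *)
  rewrite mulr_ege1//.
    rewrite invf_ge1 ?powR_gt0//.
    rewrite -[leRHS](powRr0 (lambda w)) ger_powR ?l0 ?(ltW l1)//.
    by rewrite divr_ge0 ?ltW.
  set q := (beta w + 1) / beta w.
  have q1 : 1 <= q by rewrite ler_pdivlMr// mul1r lerDl.
  by apply: (le_trans q1); exact: le1r_powR.
by rewrite (le_trans bm)// lerDr mulr_ge0 ?ltW.
Qed.

Hypothesis moment_lty : ('E_P[moment] < +oo)%E.
Hypothesis lambda_lty : ('E_P[lambda] < +oo)%E.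
Hypothesis lambda_beta_lty : ('E_P[fun w => (lambda w * beta w)%R] < +oo)%E.

Lemma integrable_moment : P.-integrable setT (EFin \o moment).
Proof.
apply: integrable_expectation_lty => //; first exact: moment_ge0.
exact: measurable_moment.
Qed.

Lemma integrable_lambda : P.-integrable setT (EFin \o lambda).
Proof. by apply: integrable_expectation_lty => // w; exact: ltW. Qed.

Lemma integrable_lambda_beta :
  P.-integrable setT (EFin \o (fun w => lambda w * beta w)).
Proof.
apply: integrable_expectation_lty => //.
  by move=> w; rewrite mulr_ge0 ?ltW.
exact: measurable_funM.
Qed.

Lemma integrable_beta : P.-integrable setT (EFin \o beta).
Proof.
apply: (le_integrable measurableT _ _
  (integrableD measurableT integrable_lambda_beta integrable_moment)).
  exact/measurable_EFinP.
move=> w _; rewrite /= lee_fin gtr0_norm//.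
exact: le_trans (beta_le w) (ler_norm _).
Qed.

(** Derivability is a conjunct of its own because [derive1] has a value even where the derivative
    does not exist. *)
Lemma kies_mixture_derive t : 0 < t < 1 ->
  derivable (kies_mixture_cdf lambda beta) t 1 /\
  kies_mixture_pdf lambda beta t =
    \int[P]_w kies_pdf (lambda w) (beta w) t.
Proof.
move=> t01; have [t0 t1] := andP t01.
(* Midpoints between [t] and the endpoints: []u, v[] contains [t] and stays away from 0 and 1. *)
pose u := t / 2; pose v := (1 + t) / 2.
have uv s : `]u, v[%classic s -> [/\ 0 < s < 1, u < s & s < v].
  by rewrite /u /v /= in_itv/= => /andP[? ?]; split => //; lra.
have d1 s w : 0 < s < 1 ->
    partial1of2 (fun s w => kies_cdf (lambda w) (beta w) s) s w =
    kies_pdf (lambda w) (beta w) s.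
  move=> s01; rewrite partial1of2E.
  exact: (@derive_val _ _ _ _ _ _ _ (is_derive_kies_cdf _ _ s01)).
have It : `]u, v[%classic t by rewrite /u /v /= in_itv/=; apply/andP; split; lra.
have intf s : `]u, v[%classic s ->
    P.-integrable setT (EFin \o (fun w => kies_cdf (lambda w) (beta w) s)).
  by move=> /uv[s01 _ _]; exact: integrable_kies_cdf.
have derf s w : `]u, v[%classic s -> setT w ->
    derivable (kies_cdf (lambda w) (beta w)) s 1.
  by move=> /uv[s01 _ _] _; case: (is_derive_kies_cdf (lambda w) (beta w) s01).
have uv0 : 0 < u * (1 - v) by rewrite mulr_gt0 /u /v//; lra.
(* On []u, v[] one has [s * (1 - s) >= u * (1 - v)], so the bound [beta w / (s * (1 - s))] becomes
   uniform in [s]. *)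
pose G w := (u * (1 - v))^-1 * beta w.
have G0 w : 0 <= G w by rewrite mulr_ge0 ?invr_ge0 ?ltW.
have intG : P.-integrable setT (EFin \o G).
  exact: (integrableZl measurableT _ integrable_beta).
have Gub s w : `]u, v[%classic s -> setT w ->
    `|partial1of2 (fun s w => kies_cdf (lambda w) (beta w) s) s w| <= G w.
  move=> /uv[s01 us sv] _; rewrite d1// ger0_norm ?kies_pdf_ge0//.
  apply: (@le_trans _ _ (beta w / (s * (1 - s)))); first exact: kies_pdf_le_inner.
  rewrite /G [leRHS]mulrC; apply: ler_wpM2l; first exact: ltW.
  rewrite lef_pV2 ?posrE//; first by rewrite /u /v in uv0 us sv *; nra.
  by case/andP: s01 => s0 s1; rewrite mulr_gt0// subr_gt0.
have cdfE : kies_mixture_cdf lambda beta =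
    (fun s => \int[P]_w kies_cdf (lambda w) (beta w) s).
  by apply/funext => s; rewrite /kies_mixture_cdf unlock.
split.
  by rewrite cdfE; exact: (derivable_under_integral measurableT It intf derf G0 intG Gub).
rewrite /kies_mixture_pdf cdfE.
rewrite (differentiation_under_integral measurableT It intf derf G0 intG Gub).
by apply: eq_Rintegral => w _; exact: d1.
Qed.

End mixture.

(** * Endpoint limits of the mixture density *)

Section mixture_limits.
Context {R : realType} {d : measure_display} {T : measurableType d}.
Variables (P : probability T R) (lambda beta : {RV P >-> R}).
Hypothesis lambda_gt0 : forall w, 0 < lambda w.
Hypothesis beta_gt0 : forall w, 0 < beta w.

Let moment w := beta w / (lambda w `^ (1 / beta w)) *
  ((beta w + 1) / beta w) `^ ((beta w + 1) / beta w).

Hypothesis moment_lty : ('E_P[moment] < +oo)%E.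
Hypothesis lambda_lty : ('E_P[lambda] < +oo)%E.
Hypothesis lambda_beta_lty : ('E_P[fun w => (lambda w * beta w)%R] < +oo)%E.

Local Notation f := (kies_mixture_pdf lambda beta).

Lemma measurable_beta_lt1 : measurable [set w | beta w < 1].
Proof.
have -> : [set w | beta w < 1] = beta @^-1` `]-oo, 1[%classic.
  by apply/seteqP; split => w /=; rewrite in_itv.
exact: measurable_funPTI.
Qed.

Lemma measurable_beta_gt1 : measurable [set w | 1 < beta w].
Proof.
have -> : [set w | 1 < beta w] = beta @^-1` `]1, +oo[%classic.
  by apply/seteqP; split => w /=; rewrite in_itv/= andbT.
exact: measurable_funPTI.
Qed.

Lemma measurable_beta_eq1 : measurable [set w | beta w = 1].
Proof. exact: (measurable_funPTI beta (measurable_set1 1)). Qed.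

Lemma integrable_kies_pdf t : 0 < t < 1 ->
  P.-integrable setT (EFin \o (fun w => kies_pdf (lambda w) (beta w) t)).
Proof.
move=> t01; have [t0 t1] := andP t01.
apply: (le_integrable measurableT _ _ (integrableZl measurableT (t * (1 - t))^-1
  (integrable_beta lambda_gt0 beta_gt0 moment_lty lambda_beta_lty))).
  exact/measurable_EFinP/measurable_kies_pdf.
move=> w _; rewrite /= lee_fin ger0_norm ?kies_pdf_ge0// mulrC.
apply: le_trans (ler_norm _).
exact: kies_pdf_le_inner.
Qed.

Lemma kies_mixture_pdf_cvg (F : set_system R) (FF : Filter F) (l : R) :
  (\forall t \near F, 0 < t < 1) ->
  \int[P]_w kies_pdf (lambda w) (beta w) t @[t --> F] --> l ->
  f t @[t --> F] --> l.
Proof.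
move=> F01; apply: cvg_trans; apply: near_eq_cvg.
apply: filterS F01 => t t01.
by rewrite (kies_mixture_derive lambda_gt0 beta_gt0 moment_lty lambda_beta_lty t01).2.
Qed.

Lemma kies_mixture_pdf_cvg1 : f t @[t --> 1^'-] --> (0 : R).
Proof.
have near01 : \forall t \near (1 : R)^'-, 2^-1 <= t < 1.
  near=> t; apply/andP; split; near: t; last exact: nbhs_left_lt.
  by apply: nbhs_left_ge; lra.
have D01 (t : R) : 2^-1 <= t < 1 -> 0 < t < 1 by lra.
apply: kies_mixture_pdf_cvg; first exact: filterS near01.
(* The limit 0 is presented as the integral of the pointwise limit, the zero function. *)
rewrite -[X in _ --> X](_ : \int[P]_w (cst 0 w : R) = 0); last first.
  by rewrite Rintegral_cst// mul0r.
apply: (@cvg_Rintegral_dominated _ _ _ _ _ _ [set t | 2^-1 <= t < 1] _ _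
  (fun w => 4 * moment w)) => //.
- exact: at_left_sequential.
- by move=> t /D01; exact: measurable_kies_pdf.
- exact: (integrableZl measurableT 4 (integrable_moment lambda_gt0 beta_gt0 moment_lty)).
- apply: aeW => w; split; first exact: kies_pdf_cvg1.
  move=> t t21; rewrite ger0_norm ?kies_pdf_ge0 ?D01//.
  exact: kies_pdf_le_near1.
Unshelve. all: by end_near. Qed.

Lemma near0_half : \forall t \near (0 : R)^'+, 0 < t <= 2^-1.
Proof.
near=> t; apply/andP; split; near: t; first exact: nbhs_right_gt.
by apply: nbhs_right_le; rewrite invr_gt0.
Unshelve. all: by end_near. Qed.

(** Serves both finite cases at 0: when [beta > 1] almost surely, the set of integration is null and
    the limit is 0. *)
Lemma kies_mixture_pdf_cvg0 : P [set w | beta w < 1] = 0%E ->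
  f t @[t --> 0^'+] --> \int[P]_(w in [set w | beta w = 1]) lambda w.
Proof.
move=> Pb.
have D01 (t : R) : 0 < t <= 2^-1 -> 0 < t < 1 by lra.
apply: kies_mixture_pdf_cvg.
  by apply: filterS near0_half => t; exact: D01.
(* The restricted function, [lambda] where [beta w = 1] and 0 elsewhere, is the almost sure
   pointwise limit of the densities. *)
rewrite Rintegral_mkcond.
apply: (@cvg_Rintegral_dominated _ _ _ _ _ _ [set t | 0 < t <= 2^-1] _ _
  (fun w => 4 * (lambda w * beta w))).
- exact: at_right_sequential.
- exact: near0_half.
- by move=> t /D01; exact: measurable_kies_pdf.
- apply/(measurable_restrictT _ measurable_beta_eq1).
  exact: measurable_funTS.
- exact: (integrableZl measurableT 4
    (integrable_lambda_beta lambda_gt0 beta_gt0 lambda_beta_lty)).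
- have : {ae P, forall w, ~ beta w < 1}.
    exists [set w | beta w < 1]; split => //; first exact: measurable_beta_lt1.
    by move=> w /= /contrapT.
  apply: filterS => w /negP; rewrite -leNgt => b1; split.
    rewrite patchE; case: ifPn => [|]; rewrite ?inE ?notin_setE/= => b1'.
      exact: kies_pdf_cvg0_eq1.
    apply: kies_pdf_cvg0_gt1 => //; rewrite lt_neqAle b1 andbT eq_sym.
    exact/eqP.
  move=> t t02; rewrite ger0_norm ?kies_pdf_ge0 ?D01//.
  apply: (le_trans (kies_pdf_le_near0 _ _ t02)) => //.
  (* The odds are at most 1 and the exponent [beta w - 1] is nonnegative, so the power is at most
     1. *)
  apply: ler_piMr; first by rewrite !mulr_ge0 ?ltW.
  have x0 := odds_gt0 (D01 _ t02).
  have x1 : t / (1 - t) <= 1 by case/andP: t02 => t0 t2; rewrite ler_pdivrMr; lra.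
  rewrite -[leRHS](powRr0 (t / (1 - t))) ger_powR ?x0//.
  by rewrite subr_ge0.
Qed.

(** The event [beta < 1] is covered by the countably many sets where [1 - beta] and [c] are both at
    least [1 / (n + 1)]; if all of these were null, so would be the event. *)
Lemma ex_beta_lt1_uniform (c : T -> R) : (forall w, 0 < c w) ->
  measurable_fun setT c -> (0 < P [set w | (beta w < 1)%R])%E ->
  exists e : R, 0 < e /\
    exists A, [/\ measurable A, (0 < P A)%E &
      forall w, A w -> beta w <= 1 - e /\ e <= c w].
Proof.
move=> c0 mc Pb.
pose A (n : nat) : set T :=
  [set w | n.+1%:R^-1 <= 1 - beta w] `&` [set w | n.+1%:R^-1 <= c w].
have mle (g : T -> R) (r : R) : measurable_fun setT g ->
    measurable [set w | r <= g w].
  move=> mg; rewrite -[X in measurable X]setTI.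
  by apply: measurable_fun_le => //; exact: measurable_cst.
have mA n : measurable (A n).
  by apply: measurableI; apply: mle => //; exact: measurable_funB.
have [n Pn] : exists n, P (A n) <> 0%E.
  apply: contrapT => /forallNP h.
  suff : P.-negligible [set w | beta w < 1].
    by move/(negligibleP _ measurable_beta_lt1) => P0; rewrite P0 ltxx in Pb.
  apply: (@negligibleS _ _ _ _ (\bigcup_n A n)); last first.
    by apply: negligible_bigcup => n; apply/negligibleP => //; exact: contrapT (h n).
  move=> w /= b1.
  pose m := Num.min (1 - beta w) (c w).
  have m0 : 0 < m by rewrite /m lt_min subr_gt0 b1 c0.
  near \oo => n; exists n => //.
  have : n.+1%:R^-1 <= m.
    by apply: ltW; near: n; exact: near_infty_natSinv_lt (PosNum m0).
  by rewrite /m le_min => /andP[].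
exists n.+1%:R^-1; split; first by rewrite invr_gt0.
exists (A n); split => //.
  by rewrite lt0e measure_ge0 andbT; exact/eqP.
by move=> w [/= h1 h2]; split => //; rewrite lerBrDr addrC -lerBrDr.
Unshelve. all: by end_near. Qed.

Lemma kies_mixture_pdf_cvgy : (0 < P [set w | (beta w < 1)%R])%E ->
  f t @[t --> 0^'+] --> +oo.
Proof.
(* The coefficient in the lower bound [kies_pdf_ge_near0]. *)
pose c w := lambda w * beta w * expR (- lambda w).
have c0 w : 0 < c w by rewrite !mulr_gt0 ?expR_gt0.
have mc : measurable_fun setT c.
  apply: measurable_funM; first exact: measurable_funM.
  by apply: measurableT_comp => //; exact: measurableT_comp.
move=> /(ex_beta_lt1_uniform c0 mc)[e [e0 [A [mA PA0 Ae]]]].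
pose p := fine (P A).
have p0 : 0 < p by rewrite fine_gt0// PA0 ltey_eq fin_num_measure.
(* On [A] the odds are at most 1 and [beta w - 1 <= - e], so the power only decreases when its
   exponent is replaced by [- e]; off [A] nonnegativity of the density suffices. *)
have lb t : 0 < t <= 2^-1 -> e * (t / (1 - t)) `^ (- e) * p <= f t.
  move=> t02; have t01 : 0 < t < 1 by lra.
  have x0 := odds_gt0 t01.
  have x1 : t / (1 - t) <= 1 by case/andP: t02 => t0 t2; rewrite ler_pdivrMr; lra.
  rewrite (kies_mixture_derive lambda_gt0 beta_gt0 moment_lty lambda_beta_lty t01).2.
  rewrite /p -Rintegral_cst// Rintegral_mkcond.
  apply: le_Rintegral => //.
  - rewrite -restrict_EFin; apply/(integrable_mkcond _ mA).
    by apply: (integrableS measurableT mA) => //; exact: finite_measure_integrable_cst.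
  - exact: integrable_kies_pdf.
  move=> w _; rewrite patchE; case: ifPn => [|_]; last exact: kies_pdf_ge0.
  rewrite inE => /Ae[be ec].
  apply: le_trans (kies_pdf_ge_near0 _ _ t02) => //.
  apply: ler_pM; rewrite ?powR_ge0 ?(ltW e0)//.
  by rewrite ger_powR ?x0//; move: be; lra.
apply/cvgryPge => M.
have xe : (t / (1 - t)) `^ e @[t --> (0 : R)^'+] --> (0 : R).
  by apply: (cvg_comp _ (fun a : R => a `^ e) (@odds_cvg0 R)); exact: powR_cvg0.
have xe0 : \forall t \near (0 : R)^'+, 0 < ((t / (1 - t)) `^ e)^-1.
  apply: filterS near0_half => t t02.
  by rewrite invr_gt0 powR_gt0// odds_gt0//; case/andP: t02 => t0 t2; lra.
have : ((t / (1 - t)) `^ e)^-1 @[t --> (0 : R)^'+] --> +oo.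
  apply/(gtr0_cvgV0 xe0); apply: cvg_trans xe; apply: near_eq_cvg.
  by apply: nearW => t /=; rewrite invrK.
(* Threshold chosen so that the lower bound [lb] reaches [M]. *)
move=> /cvgryPge/(_ (M / (e * p))) h.
near=> t.
have t02 : 0 < t <= 2^-1 by near: t; exact: near0_half.
apply: le_trans (lb t t02).
rewrite powRN mulrAC -ler_pdivrMl ?mulr_gt0// mulrC.
near: t; exact: h.
Unshelve. all: by end_near. Qed.

End mixture_limits.

(** * Probability measures with a prescribed density *)

Lemma null_integral_gt0 (R : realType) (d : measure_display)
    (T : measurableType d) (mu : {measure set T -> \bar R}) (A : set T)
    (g : T -> R) :
  (forall w, 0 < g w) -> measurable_fun setT g -> measurable A ->
  (\int[mu]_(w in A) (g w)%:E = 0)%E -> mu A = 0%E.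
Proof.
move=> g0 mg mA gA; apply/negligibleP => //.
have mgA : measurable_fun A (EFin \o g).
  by apply: measurable_funTS; exact/measurable_EFinP.
have : ae_eq mu A (EFin \o g) (cst 0%E).
  apply/(ae_eq_integral_abs _ mA mgA); rewrite -[RHS]gA.
  by apply: eq_integral => w _ /=; rewrite ger0_norm// ltW.
(* As [g] never vanishes, every point of [A] violates the almost everywhere equality with 0. *)
apply: negligibleS => w Aw /=; apply/existsNP; exists Aw.
by move=> [] /eqP; rewrite gt_eqF.
Qed.

Section density_probability.
Context {R : realType} {d : measure_display} {T : measurableType d}.
Variables (mu : {measure set T -> \bar R}) (g : T -> R).
Hypothesis g0 : forall w, 0 <= g w.
Hypothesis mg : measurable_fun setT g.
Hypothesis g1 : (\int[mu]_w (g w)%:E = 1)%E.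

(* The proofs are arguments so that the canonical structures below can be
   inferred from the term. *)
Definition density_probability of (forall w, 0 <= g w) & measurable_fun setT g
    & (\int[mu]_w (g w)%:E = 1)%E :=
  fun A : set T => (\int[mu]_(w in A) (g w)%:E)%E.

Local Notation Q := (density_probability g0 mg g1).

Let Q0 : Q set0 = 0%E. Proof. exact: integral_set0. Qed.

Let Qge0 A : (0 <= Q A)%E.
Proof. by apply: integral_ge0 => w _; rewrite lee_fin. Qed.

Let Qsigma : semi_sigma_additive Q.
Proof.
apply: semi_sigma_additive_nng_induced; first exact/measurable_EFinP.
by move=> w; rewrite lee_fin.
Qed.

HB.instance Definition _ := isMeasure.Build _ _ _ Q Q0 Qge0 Qsigma.

HB.instance Definition _ := Measure_isProbability.Build _ _ _ Q g1.

End density_probability.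

(** The witness integrates [g] against [P]. Positivity of [g] yields [P] dominated by [Q], and the
    Radon-Nikodym derivative agrees with [g] almost everywhere because both have integral [Q E] over
    each measurable [E]. *)
Lemma ex_equivalent_with_density (R : realType) (d : measure_display)
    (T : measurableType d) (P : probability T R) (g : T -> R) :
  (forall w, 0 < g w) -> measurable_fun setT g ->
  (\int[P]_w (g w)%:E = 1)%E -> exists Q, equivalent_with_density P Q g.
Proof.
move=> g0 mg g1; have g0' w : 0 <= g w by exact: ltW.
have mEg : measurable_fun setT (EFin \o g) by exact/measurable_EFinP.
pose Q : probability T R := density_probability g0' mg g1.
have QP : Q `<< P.
  apply/null_content_dominatesP => A mA PA.
  by apply: null_set_integral => //; exact: measurable_funTS.
exists Q; split => //.
  by apply/null_content_dominatesP => A mA; exact: null_integral_gt0.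
apply: integral_ae_eq => //; first exact: Radon_Nikodym_integrable.
by move=> E _ mE; rewrite -Radon_Nikodym_integral.
Qed.

(** Recovers [Q] from its derivative, so that the value at 0 can be computed for every admissible
    [Q] and not just for the one constructed. *)
Lemma equivalent_with_density_integral (R : realType) (d : measure_display)
    (T : measurableType d) (P Q : probability T R) (g : T -> R) (A : set T) :
  measurable_fun setT g -> equivalent_with_density P Q g -> measurable A ->
  Q A = (\int[P]_(w in A) (g w)%:E)%E.
Proof.
move=> mg [QP _ dQ] mA.
rewrite [LHS](Radon_Nikodym_integral (nu := charge_of_finite_measure Q) QP mA).
apply: ae_eq_integral => //.
- by apply: measurable_funTS; apply: measurable_int; exact: Radon_Nikodym_integrable.
- by apply: measurable_funTS; exact/measurable_EFinP.
- exact: ae_eq_subset dQ.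
Qed.

Unset Implicit Arguments.
Set Strict Implicit.

Theorem proposition3p7 (R : realType) (d : measure_display)
    (T : measurableType d) (P : probability T R)
    (lambda beta : {RV P >-> R})
    (lambda_gt0 : forall w, 0 < lambda w)
    (beta_gt0 : forall w, 0 < beta w)
    (moment_lty : ('E_P[fun w =>
        (beta w / (lambda w `^ (1 / beta w)) *
        ((beta w + 1) / beta w) `^ ((beta w + 1) / beta w))%R] < +oo)%E)
    (lambda_lty : ('E_P[lambda] < +oo)%E)
    (lambda_beta_lty : ('E_P[fun w => (lambda w * beta w)%R] < +oo)%E) :
  let F := kies_mixture_cdf lambda beta in
  let f := kies_mixture_pdf lambda beta in
  [/\ (forall t : R, 0 < t < 1 -> derivable F t 1),
      f t @[t --> 1^'-] --> (0 : R),
      (P [set w | 1 < beta w] = 1%E -> f t @[t --> 0^'+] --> (0 : R)),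
      ((0 < P [set w | beta w = 1%R])%E -> P [set w | beta w < 1] = 0%E ->
        let is_Q (Q : probability T R) :=
          equivalent_with_density P Q
            (fun w => lambda w / fine 'E_P[lambda]%E) in
        (exists Q : probability T R, is_Q Q) /\
        (forall Q : probability T R, is_Q Q ->
          f t @[t --> 0^'+] -->
            fine (Q [set w | beta w = 1%R]) * fine 'E_P[lambda]%E)) &
      ((0 < P [set w | (beta w < 1)%R])%E -> f t @[t --> 0^'+] --> +oo)].
Proof.
have cvg0 := kies_mixture_pdf_cvg0 lambda_gt0 beta_gt0 moment_lty lambda_beta_lty.
move=> F f; split.
- move=> t t01.
  exact: (kies_mixture_derive lambda_gt0 beta_gt0 moment_lty lambda_beta_lty t01).1.
- exact: kies_mixture_pdf_cvg1.
- move=> Pb; have mgt := measurable_beta_gt1 beta.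
  (* This null complement contains both [beta < 1] and [beta = 1]. *)
  have PC : P (~` [set w | 1 < beta w]) = 0%E.
    by rewrite probability_setC// Pb subee.
  have null (A : set T) : measurable A -> A `<=` ~` [set w | 1 < beta w] -> P A = 0%E.
    by move=> mA AC; apply: subset_measure0 PC => //; exact: measurableC.
  have Plt : P [set w | beta w < 1] = 0%E.
    apply: null; first exact: measurable_beta_lt1.
    by move=> w /= b1; rewrite lt_gtF.
  have Peq : P [set w | beta w = 1] = 0%E.
    apply: null; first exact: measurable_beta_eq1.
    by move=> w /= ->; rewrite ltxx.
  rewrite -[X in _ --> X](_ : \int[P]_(w in [set w | beta w = 1]) lambda w = 0).
    exact: cvg0.
  rewrite /Rintegral null_set_integral//; first exact: measurable_beta_eq1.
  by apply: measurable_funTS; exact/measurable_EFinP.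
- move=> _ Plt is_Q.
  have intl := integrable_lambda lambda_gt0 lambda_lty.
  have Efin : 'E_P[lambda]%E \is a fin_num.
    by rewrite unlock; exact: integrable_fin_num.
  have intE : (\int[P]_w (lambda w)%:E = (fine 'E_P[lambda])%:E)%E.
    by rewrite fineK// unlock.
  (* Makes the division in the density genuine: a zero mean of the positive [lambda] would force the
     whole space to be null. *)
  have El_gt0 : 0 < fine 'E_P[lambda]%E.
    rewrite lt_neqAle fine_ge0 ?expectation_ge0//; last by move=> w; exact: ltW.
    rewrite andbT eq_sym; apply/eqP => E0.
    have : P setT = 0%E.
      apply: (null_integral_gt0 lambda_gt0) => //.
      by rewrite intE E0.
    by rewrite probability_setT => /eqP; rewrite onee_eq0.
  pose g w := lambda w / fine 'E_P[lambda]%E.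
  have mg : measurable_fun setT g by exact: measurable_funM.
  have intg (A : set T) : measurable A -> (\int[P]_(w in A) (g w)%:E =
      \int[P]_(w in A) (lambda w)%:E * ((fine 'E_P[lambda])^-1)%:E)%E.
    move=> mA; rewrite -integralZr//; last exact: (integrableS measurableT).
  split.
    apply: ex_equivalent_with_density => //.
      by move=> w; rewrite divr_gt0.
    by rewrite intg// intE -EFinM divff// gt_eqF.
  move=> Q QQ.
  have meq := measurable_beta_eq1 beta.
  (* [Q] of the event is the integral of [lambda] over it divided by the mean of [lambda];
     multiplying by that mean leaves the limit in [cvg0]. *)
  rewrite (equivalent_with_density_integral mg QQ meq) intg// fineM//; last first.
    apply: integrable_fin_num => //; exact: (integrableS measurableT meq).
  rewrite mulfVK ?gt_eqF//.
  exact: cvg0.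
- exact: kies_mixture_pdf_cvgy.
Qed.
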